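(* Let $n\ge 2$ be an integer and $\hat S_n=\{(x,k)\in\mathbb{Z}_{\ge0}^2:\hat F_n(x,k)>0\}$. If $n$ is even, then $$|\hat S_n|=\begin{cases}1+\frac{n(n+2)}{8}-\sum_{i=1}^{n/2}\left\lfloor\frac{n}{2i+1}\right\rfloor+\frac{n^2}{16} & \text{if } 4\mid n,\\[2pt] 1+\frac{n(n+2)}{8}-\sum_{i=1}^{n/2}\left\lfloor\frac{n}{2i+1}\right\rfloor+\frac{n^2-4}{16} & \text{if } 4\nmid n.\end{cases}$$ If $n$ is odd, then $$|\hat S_n|=\begin{cases}1+\frac{5(n+3)(n-1)}{16}-\sum_{i=1}^{n-2}\left\lfloor\frac{n}{i+1}\right\rfloor & \text{if } 4\mid (n-1),\\[2pt] 1+\frac{(n+3)(n-1)}{4}-\sum_{i=1}^{n-2}\left\lfloor\frac{n}{i+1}\right\rfloor+\frac{(n+1)^2}{16} & \text{if } 4\mid (n+1).\end{cases}$$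
   Context: For integers $n,x,k\ge 0$, $\hat B_n^{x,k}$ denotes the set of palindromic binary strings (strings equal to their reversal) of length $n$ that contain exactly $x$ zeros and in which the longest block of consecutive zeros has length exactly $k$ (the all-ones string lies in $\hat B_n^{0,0}$). $\hat F_n(x,k)=|\hat B_n^{x,k}|$. *)

(* Defs.v *)
From mathcomp Require Import all_boot all_order all_algebra.
From mathcomp Require Import classical_sets cardinality.

Set Implicit Arguments.
Unset Strict Implicit.
Unset Printing Implicit Defensive.

Local Open Scope classical_set_scope.

(* Binary strings are boolean sequences, with 0 = false and 1 = true. *)

Definition longest_zero_block (w : seq bool) : nat :=
  \max_(l < (size w).+1 | infix (nseq l false) w) l.

Definition Bhat (n x k : nat) : {set n.-tuple bool} :=
  [set w : n.-tuple bool | [&& rev w == w :> seq bool,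
     count_mem false w == x & longest_zero_block w == k]]%SET.

Definition Fhat (n x k : nat) : nat := #|Bhat n x k|.

Definition Shat (n : nat) : set (nat * nat) :=
  [set p | 0 < Fhat n p.1 p.2].

(* Main.v *)
Require Import Defs.
From mathcomp Require Import all_boot all_order all_algebra.
From mathcomp Require Import finmap classical_sets cardinality.
From mathcomp Require Import zify lra.

(* Cutting a palindrome at its centre shows that (x, k) is realizable exactly
   when the n - x ones leave enough gaps, n < (n - x + 1)(k + 1), when x is even
   if n is, and when the longest block can be placed: either off the centre, where
   its mirror image forces 2k <= x, or at the centre, where k, x and n all have
   the same parity. For a fixed k > 0 and q = n %/ (k + 1) this counts, for
   n = 2h, the y = x / 2 with y + ceil(q / 2) <= h that are at least k / 2 or k
   according to the parity of k; for n odd the count is linear in k minus q. The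
   sums over k are then elementary, except that for even n the terms ceil(q / 2)
   are turned into the n %/ (2i + 1) by counting the pairs (i, d) with
   (2i + 1) d <= n in two ways. *)

Local Open Scope classical_set_scope.
Local Open Scope nat_scope.

(** * Zero runs and the longest zero block *)

(** With the default [true], positions past the end read as ones, so a nonempty run lies inside [w]
    without any length condition. *)
Definition zero_run_le k w :=
  forall p l, (forall i, p <= i < p + l -> nth true w i = false) -> l <= k.

Lemma infix_nseq_falseP l w :
  reflect (exists p, [/\ p + l <= size w &
             forall i, p <= i < p + l -> nth true w i = false])
          (infix (nseq l false) w).
Proof.
apply: (iffP (@infixP _ (nseq l false) w)) => [[s [t ->]]|[p [pl wE]]].
  exists (size s); split; first by rewrite !size_cat size_nseq leq_add2l leq_addr.
  move=> i /andP[si il]; rewrite nth_cat ltnNge si /= nth_cat size_nseq.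
  by rewrite nth_nseq ltn_subLR // il.
exists (take p w), (drop (p + l) w).
rewrite -{1}(cat_take_drop p w) -{1}(cat_take_drop l (drop p w)) drop_drop.
rewrite [l + p]addnC; congr (_ ++ (_ ++ _)).
have sz : size (take l (drop p w)) = l.
  by apply: size_takel; rewrite size_drop; lia.
apply: (@eq_from_nth _ true); first by rewrite sz size_nseq.
move=> i; rewrite sz => il; rewrite nth_take // nth_drop wE ?nth_nseq ?il //.
lia.
Qed.

Lemma leq_longest_zero_block l w :
  infix (nseq l false) w -> l <= longest_zero_block w.
Proof.
move=> lw; have lsz : l < (size w).+1 by rewrite ltnS -(size_nseq l false) size_infix.
exact: (@leq_bigmax_cond _ _ (fun i : 'I_(size w).+1 => i : nat) (Ordinal lsz)).
Qed.

Lemma infix_longest_zero_block w :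
  infix (nseq (longest_zero_block w) false) w.
Proof.
have [i0 iP ->] : {i0 : 'I_(size w).+1 | infix (nseq i0 false) w &
    longest_zero_block w = i0}.
  apply: eq_bigmax_cond; apply/card_gt0P; exists ord0.
  exact: infix0s.
by [].
Qed.

Lemma longest_zero_block_leP k w :
  longest_zero_block w <= k <-> zero_run_le k w.
Proof.
split=> [wk p l pl|wk].
  case: (posnP l) => [->//|l0].
  apply: leq_trans wk; apply: leq_longest_zero_block; apply/infix_nseq_falseP.
  exists p; split=> //; case: leqP => // lt.
  have := pl (p + l.-1); rewrite nth_default; last by lia.
  by move/(_ ltac:(lia)).
have /infix_nseq_falseP[p [_ pl]] := infix_longest_zero_block w.
exact: wk pl.
Qed.

Lemma zero_run_le_nseq k c : c <= k -> zero_run_le k (nseq c false).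
Proof.
move=> ck p l pl; rewrite leqNgt; apply/negP=> kl.
have := pl (p + c); rewrite nth_default ?size_nseq; last by lia.
by move/(_ ltac:(lia)).
Qed.

Lemma zero_run_le_cat_true k s t :
  zero_run_le k s /\ zero_run_le k t <-> zero_run_le k (s ++ true :: t).
Proof.
have E i : nth true (s ++ true :: t) (size s + i.+1) = nth true t i.
  by rewrite nth_cat ltnNge leq_addr /= addKn.
split=> [[sk tk] p l pl|stk]; last first.
  split=> p l pl.
    apply: (stk p) => i pi; rewrite nth_cat; case: ltnP => [_|si]; first exact: pl.
    by have := pl i pi; rewrite nth_default.
  apply: (stk (size s + p.+1)) => i pi.
  have -> : i = size s + (i - (size s).+1).+1 by lia.
  by rewrite E; apply: pl; lia.
case: (leqP p (size s)) => ps.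
  apply: (sk p) => i pi; case: (ltnP i (size s)) => si; last first.
    have := pl (size s); rewrite nth_cat ltnn subnn /=.
    by move/(_ ltac:(lia)).
  by rewrite -(pl i pi) nth_cat si.
apply: (tk (p - size s).-1) => i pi; rewrite -E; apply: pl; lia.
Qed.

Lemma zero_run_le_rev k s : zero_run_le k s -> zero_run_le k (rev s).
Proof.
move=> sk p l pl; case: (posnP l) => [->//|l0].
have ps : p + l <= size s.
  rewrite leqNgt; apply/negP => lt.
  have := pl (p + l.-1); rewrite nth_default ?size_rev; last by lia.
  by move/(_ ltac:(lia)).
apply: (sk (size s - (p + l))) => i pi.
have := pl (size s - i.+1); rewrite nth_rev; last by lia.
by rewrite subnSK ?subKn; [apply|..]; lia.
Qed.

(** Cutting at a one makes both size + 1 and ones + 1 additive, so the bound size + 1 <= (ones +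
    1)(k + 1) passes from the two parts to the whole. *)
Lemma zero_run_le_size k w :
  zero_run_le k w -> size w < (count_mem true w).+1 * k.+1.
Proof.
move: {2}(size w) (leqnn (size w)) => N.
elim: N w => [|N IH] w wN wk; first by lia.
case: (boolP (true \in w)) => [|/negP nw]; last first.
  suff : size w <= k by nia.
  apply: (wk 0) => i; rewrite add0n => /andP[_ iw].
  by apply/negbTE/negP => wi; apply: nw; rewrite -wi mem_nth.
move=> tw; case/path.splitPr: w / tw wN wk => /= s t wN wk.
have {wN}: size s + size t <= N by rewrite size_cat /= in wN; lia.
have [sk tk] : zero_run_le k s /\ zero_run_le k t by exact/zero_run_le_cat_true.
move=> stN.
have := IH s ltac:(lia) sk; have := IH t ltac:(lia) tk.
rewrite count_cat size_cat /=; nia.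
Qed.

(** * Letter counts and greedy filling of gaps *)

Lemma count_mem_bool (b : bool) w : count_mem b w + count_mem (~~ b) w = size w.
Proof.
rewrite -(count_predC (pred1 b) w); congr (_ + _); apply: eq_count => c /=.
by case: b c => [] [].
Qed.

(* [greedy_blocks k u z] has [u] ones and [z] zeros when [z <= u.+1 * k]. *)
Fixpoint greedy_blocks k u z : seq bool :=
  nseq (minn k z) false ++
  if u is u'.+1 then true :: greedy_blocks k u' (z - k) else [::].

Lemma count_false_greedy_blocks k u z :
  z <= u.+1 * k -> count_mem false (greedy_blocks k u z) = z.
Proof.
elim: u z => [|u IH] z zu /=; rewrite ?cats0 ?count_cat count_nseq /=; first lia.
rewrite IH; lia.
Qed.

Lemma count_true_greedy_blocks k u z : count_mem true (greedy_blocks k u z) = u.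
Proof.
by elim: u z => [|u IH] z /=; rewrite ?cats0 ?count_cat count_nseq //= IH; lia.
Qed.

Lemma zero_run_le_greedy_blocks k u z : zero_run_le k (greedy_blocks k u z).
Proof.
elim: u z => [|u IH] z /=; rewrite ?cats0.
  by apply: zero_run_le_nseq; lia.
by apply/zero_run_le_cat_true; split=> //; apply: zero_run_le_nseq; lia.
Qed.

Lemma infix_greedy_blocks k u z :
  k <= z -> infix (nseq k false) (greedy_blocks k u z).
Proof. by move=> kz; case: u => [|u] /=; rewrite (minn_idPl kz) prefixW ?prefix_prefix. Qed.

(** * Necessary conditions on a palindrome *)

(** In even length the second half mirrors the first, so every count is doubled. *)
Lemma odd_count_palindrome (T : eqType) (a : pred T) (w : seq T) :
  rev w = w -> odd (count a w) -> odd (size w).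
Proof.
move=> wP; apply: contraLR => /negbTE wE.
have szE : size w = (size w)./2 + (size w)./2 by rewrite addnn even_halfK ?wE.
have := take_rev (size w)./2 w; rewrite wP {2}szE addnK => takeE.
rewrite -{1}(cat_take_drop (size w)./2 w) takeE count_cat count_rev.
by rewrite addnn odd_double.
Qed.

(** The block starts at [size s] and its mirror image at [size t]. If disjoint, they hold 2k zeros;
    if they overlap, they merge into a run of length size t - size s + k > k, which is excluded. *)
Lemma zeros_ge_of_off_center_block k s t (w := s ++ nseq k false ++ t) :
  rev w = w -> zero_run_le k w -> size s < size t ->
  2 * k <= count_mem false w.
Proof.
move=> wP wk st; have wE : w = rev t ++ nseq k false ++ rev s.
  by rewrite -wP !rev_cat rev_nseq catA.
case: (leqP (size s + k) (size t)) => skt.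
  have tE : t = drop (size s + k) (rev t) ++ nseq k false ++ rev s.
    have dw : drop (size s + k) w = t.
      by rewrite /w catA drop_size_cat // size_cat size_nseq.
    rewrite -{1}dw {1}wE drop_cat size_rev ltn_neqAle skt andbT.
    case: eqP => //= ->.
    by rewrite subnn drop0 drop_oversize ?size_rev.
  by rewrite /w !count_cat {1}tE !count_cat !count_nseq /= !mul1n; lia.
have szw : size w = size s + k + size t by rewrite !size_cat size_nseq addnA.
have E i : size s <= i < size s + k -> nth true w i = false.
  move=> /andP[si il]; rewrite nth_cat ltnNge si /= nth_cat size_nseq.
  by rewrite nth_nseq ltn_subLR // il.
suff : size t - size s + k <= k by lia.
apply: (wk (size s)) => i si; case: (ltnP i (size s + k)) => isk.
  by apply: E; lia.
rewrite -wP nth_rev ?szw; last lia.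
by apply: E; lia.
Qed.

Definition admissible n x k :=
  [&& x <= n, n < (n - x).+1 * k.+1, odd x ==> odd n &
      (2 * k <= x) || [&& k <= x, odd k == odd n & odd x == odd n]].

Lemma admissible_palindrome w : rev w = w ->
  admissible (size w) (count_mem false w) (longest_zero_block w).
Proof.
move=> wP; set k := longest_zero_block w.
have wk : zero_run_le k w by apply/longest_zero_block_leP.
have xn : count_mem false w <= size w by apply: count_size.
have ones : size w - count_mem false w = count_mem true w.
  by have := count_mem_bool false w => /=; lia.
apply/and4P; split=> //.
- by rewrite ones; apply: zero_run_le_size.
- by apply/implyP; apply: odd_count_palindrome.
have := infix_longest_zero_block w; rewrite -/k => /infixP[/= s [t wE]].
case: (ltngtP (size s) (size t)) => st.
- by rewrite {1}wE zeros_ge_of_off_center_block -?wE.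
- have wE' : w = rev t ++ nseq k false ++ rev s.
    by rewrite -wP wE !rev_cat rev_nseq catA.
  by rewrite {1}wE' zeros_ge_of_off_center_block -?wE' ?size_rev.
(* The block is central, so [rev t = s]: outside it zeros and letters come in mirror pairs, and k, x
   and n have the same parity. *)
apply/orP; right.
have /eqP : rev t ++ nseq k false ++ rev s = s ++ nseq k false ++ t.
  by rewrite -wE -wP wE !rev_cat rev_nseq catA.
rewrite eqseq_cat ?size_rev // => /andP[/eqP sE _].
by rewrite wE -sE !count_cat !size_cat count_rev size_rev count_nseq size_nseq /= mul1n; lia.
Qed.

(** * Construction of palindromes *)

(** The string is [rev f], then c central zeros, then [f]. Since [f] is empty or starts with a one,
    the central block is not prolonged; a block of length k is either the central one or the first
    one in [f]. *)
Lemma palindrome_even_ones k c u z :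
  c <= k -> z <= u * k -> c = k \/ k <= z /\ 0 < u ->
  exists w, [/\ size w = 2 * (u + z) + c, rev w = w,
    count_mem false w = 2 * z + c & longest_zero_block w = k].
Proof.
move=> ck zu kk.
pose f := if u is u'.+1 then true :: greedy_blocks k u' z else [::].
have fF : count_mem false f = z.
  by rewrite /f; case: u zu {kk f} => [|u] zu /=; rewrite ?count_false_greedy_blocks; lia.
have fT : count_mem true f = u.
  by rewrite /f; case: (u) => [|u'] //=; rewrite count_true_greedy_blocks.
exists (rev f ++ nseq c false ++ f); split.
- by rewrite !size_cat size_rev size_nseq -(count_mem_bool true f) /= fF fT; lia.
- by rewrite !rev_cat revK rev_nseq catA.
- by rewrite !count_cat count_rev fF count_nseq /=; lia.
apply/eqP; rewrite eqn_leq; apply/andP; split.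
  apply/longest_zero_block_leP; rewrite /f; case: (u) => [|u'].
    by rewrite cats0; apply: zero_run_le_nseq.
  rewrite rev_cons cat_rcons; apply/zero_run_le_cat_true; split.
    exact/zero_run_le_rev/zero_run_le_greedy_blocks.
  apply/zero_run_le_cat_true; split; first exact: zero_run_le_nseq.
  exact: zero_run_le_greedy_blocks.
apply: leq_longest_zero_block; case: kk => [<-|[kz u0]].
  exact: infix_infix.
apply/infix_catl/infix_catl; rewrite /f; case: u u0 {zu f fF fT} => // u _.
by rewrite -cat1s; apply/infix_catl/infix_greedy_blocks.
Qed.

Lemma palindrome_odd_ones k u z :
  k <= z -> z <= u.+1 * k ->
  exists w, [/\ size w = (2 * (u + z)).+1, rev w = w,
    count_mem false w = 2 * z & longest_zero_block w = k].
Proof.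
move=> kz zu; pose g := greedy_blocks k u z.
have gF : count_mem false g = z by rewrite count_false_greedy_blocks.
have gT : count_mem true g = u by rewrite count_true_greedy_blocks.
exists (rev g ++ true :: g); split.
- by rewrite size_cat size_rev /= -(count_mem_bool true g) /= gF gT; lia.
- by rewrite rev_cat revK rev_cons cat_rcons.
- by rewrite !count_cat count_rev /= gF; lia.
apply/eqP; rewrite eqn_leq; apply/andP; split.
  apply/longest_zero_block_leP/zero_run_le_cat_true.
  by split; [apply: zero_run_le_rev|]; apply: zero_run_le_greedy_blocks.
apply: leq_longest_zero_block; apply: infix_catl; rewrite -cat1s.
exact/infix_catl/infix_greedy_blocks.
Qed.

Lemma admissible_realizable n x k : admissible n x k ->
  exists w, [/\ size w = n, rev w = w,
    count_mem false w = x & longest_zero_block w = k].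
Proof.
case/and4P=> xn nk oxn xk.
have nE : n = n - x + x by rewrite subnK.
have pE := odd_double_half (n - x); set u := (n - x)./2 in pE.
have xE := odd_double_half x; set z := x./2 in xE.
have on : odd n = odd (n - x) (+) odd x by rewrite {1}nE oddD.
rewrite -mul2n in pE; rewrite -mul2n in xE.
move: (n - x) pE nE nk on => p pE nE nk on.
move: pE on; case: (odd p) => pE on.
  (* An odd number of ones puts a one at the centre, so x is even and each half receives z = x / 2
     zeros. *)
  have ox : odd x = false by case: (odd x) oxn on => //= ->.
  have kz : k <= z.
    case/orP: xk => [kx|/and3P[_ _]]; last by rewrite on ox.
    by rewrite ox in xE; clear -kx xE; lia.
  have zu : z <= u.+1 * k.
    by rewrite ox in xE; clear -xE pE nE nk; nia.
  have [w [w1 w2 w3 w4]] := palindrome_odd_ones _ _ _ kz zu.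
  by exists w; rewrite w1 w3 -xE ox nE -pE; split=> //; clear -xE ox; lia.
have {nk} xku : x <= 2 * (u * k) + k by clear -nk nE pE; nia.
have {nE} nE : n = 2 * u + x by clear -nE pE; lia.
(* With 2u ones, a k of the parity of x can be the length of the central block. Otherwise
   [2 * k <= x], and the block of length k goes into each half. *)
rewrite /= in on; case: (boolP (odd k == odd x)) => [/eqP kx|kx].
  have kx' : k <= x.
    by case/orP: xk => [kx'|/andP[]//]; clear -kx'; lia.
  have cE := odd_double_half (x - k).
  rewrite oddB // kx addbb -mul2n in cE.
  have zu : (x - k)./2 <= u * k by clear -cE xku; lia.
  have [w [w1 w2 w3 w4]] :=
    palindrome_even_ones _ _ _ _ (leqnn k) zu (or_introl erefl).
  by exists w; split=> //; rewrite ?w1 ?w3 ?nE; clear -cE kx'; lia.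
have kx' : 2 * k <= x.
  case/orP: xk => // /and3P[_ /eqP ok /eqP ox].
  by rewrite ok ox eqxx in kx.
have k0 : 0 < k.
  rewrite lt0n; apply: contraNN kx => /eqP k0.
  by move: xku; rewrite k0 muln0 addn0 leqn0 => /eqP ->.
have u0 : 0 < u by case: (u) xku => //; clear -kx' k0; lia.
have kuk : k <= u * k by rewrite leq_pmull.
(* Each half holds at most u * k zeros. If z fits, the centre takes only the parity bit of x;
   otherwise the halves are filled and the centre takes the overflow, at most k. *)
case: (leqP z (u * k)) => xuk.
  have ck : odd x <= k by case: (odd x).
  have kz : k <= z by clear -xE kx'; case: (odd x) xE; lia.
  have [w [w1 w2 w3 w4]] :=
    palindrome_even_ones _ _ _ _ ck xuk (or_intror (conj kz u0)).
  exists w; split=> //; last by rewrite w3 addnC.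
  by rewrite w1 nE -{2}xE mulnDr addnC addnCA [_ + 2 * z]addnC addnA.
have cx : 2 * (u * k) <= x by clear -xuk xE; lia.
have ck : x - 2 * (u * k) <= k by rewrite leq_subLR.
have [w [w1 w2 w3 w4]] :=
  palindrome_even_ones _ _ _ _ ck (leqnn (u * k)) (or_intror (conj kuk u0)).
exists w; split=> //; first by rewrite w1 nE mulnDr -addnA subnKC.
by rewrite w3 subnKC.
Qed.

(** * Reduction to counting admissible pairs *)

Lemma Fhat_gt0 n x k : (0 < Fhat n x k) = admissible n x k.
Proof.
apply/card_gt0P/idP => [[w]|].
  rewrite inE => /and3P[/eqP wP /eqP <- /eqP <-].
  by rewrite -[n in admissible n](size_tuple w); apply: admissible_palindrome.
move/admissible_realizable => [w [/eqP wn wP wx wk]].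
by exists (Tuple wn); rewrite inE /= wP wx wk !eqxx.
Qed.

(** The bound [N] is left free because admissibility forces [x <= n]; the counts below take the even
    value [2 * h.+1], which splits by the parity of x. *)
Lemma card_Shat n N : n < N ->
  (Shat n #= `I_(\sum_(0 <= k < n.+1) \sum_(0 <= x < N) admissible n x k))%card.
Proof.
move=> nN.
pose r := [seq p <- allpairs (fun k x => (x, k)) (iota 0 n.+1) (iota 0 N) |
             admissible n p.1 p.2].
have r_uniq : uniq r.
  by apply/filter_uniq/allpairs_uniq; rewrite ?iota_uniq // => -[? ?] [? ?] _ _ [-> ->].
have mem_r p : (p \in r) = admissible n p.1 p.2.
  rewrite mem_filter; case: (boolP (admissible _ _ _)) => // adm; rewrite andTb.
  case: p adm => x k /and4P[xn _ _ xk]; simpl in xn, xk.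
  by apply: (allpairs_f (fun k x => (x, k))); rewrite mem_iota; lia.
have -> : Shat n = [set` [fset p in r]%fset].
  by apply/seteqP; split=> -[x k]; rewrite /Shat /= Fhat_gt0 inE mem_r.
apply/card_eq_fsetP; rewrite card_fseq undup_id // size_filter -sum1_count.
rewrite big_mkcond big_allpairs_dep /index_iota !subn0.
apply: eq_bigr => k _; apply: eq_bigr => x _.
by case: ifP.
Qed.

(** * The number of admissible x for a fixed k *)

Lemma sum_nat_even_odd (F : nat -> nat) h :
  \sum_(0 <= x < 2 * h) F x =
  \sum_(0 <= y < h) F (2 * y) + \sum_(0 <= y < h) F (2 * y).+1.
Proof.
elim: h => [|h IH]; first by rewrite muln0 !big_geq.
rewrite mulnS !addSn add0n !big_nat_recr //= IH; lia.
Qed.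

Lemma sum_nat_between N a b : \sum_(0 <= y < N) (a <= y < b) = minn b N - a.
Proof.
elim: N => [|N IH]; first by rewrite big_geq; lia.
by rewrite big_nat_recr //= IH; lia.
Qed.

(** This bound and the next keep the truncated subtractions in the counts exact, by ensuring that
    the lower end of the interval of y does not pass its upper end by more than rounding allows. *)
Lemma divnS_addn_le n k : k <= n -> n %/ k.+1 + k <= n.
Proof.
move=> kn; have := leq_trunc_div n k.+1; have : (n < k.+1) || (0 < n %/ k.+1).
  by rewrite divn_gt0 //; lia.
by case: ltnP => [/divn_small->|_ /= q0]; nia.
Qed.

Lemma divnS_add2n_le n k : 0 < k -> 2 * k <= n -> n %/ k.+1 + 2 * k <= n.+1.
Proof.
move=> k0 kn; have := leq_trunc_div n k.+1.
by case: (n %/ k.+1) => [|[|q]]; nia.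
Qed.

(** This covers large k, where no off-centre block fits: the quotient 1 makes the truncated formulas
    still agree. *)
Lemma divnS_eq1 n k : k < n -> n <= 2 * k + 1 -> n %/ k.+1 = 1.
Proof.
move=> kn nk; apply/eqP; rewrite eqn_leq divn_gt0 // kn andbT.
by rewrite -ltnS ltn_divLR //; lia.
Qed.

(** The gap condition asks for at least n %/ k.+1 ones, which makes it linear in x. *)
Lemma admissibleE n x k :
  admissible n x k = [&& x + n %/ k.+1 <= n, odd x ==> odd n &
      (2 * k <= x) || [&& k <= x, odd k == odd n & odd x == odd n]].
Proof.
rewrite /admissible andbA -ltn_divLR // ltnS; congr andb.
by move: (n %/ k.+1) => q; lia.
Qed.

Lemma admissible_double n y k : admissible n (2 * y) k =
  (2 * y + n %/ k.+1 <= n) && ((k <= y) || [&& k <= 2 * y, ~~ odd k & ~~ odd n]).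
Proof.
rewrite admissibleE oddM /= leq_pmul2l //; congr (_ && (_ || _)).
by case: (odd n); case: (odd k); rewrite ?andbF.
Qed.

Lemma admissible_doubleS n y k : admissible n (2 * y).+1 k =
  [&& (2 * y).+1 + n %/ k.+1 <= n, odd n &
      (k <= y) || (k <= (2 * y).+1) && odd k].
Proof.
rewrite admissibleE oddS oddM /=; congr andb.
have -> : (2 * k <= (2 * y).+1) = (k <= y) by lia.
by case: (odd n) => //; case: (odd k); rewrite ?andbF.
Qed.

Lemma leq_double_sub y q h : (2 * y + q <= 2 * h) = (y < h.+1 - uphalf q).
Proof. by lia. Qed.

(** The guard [q <= n] matters: without it the truncated [n - q] would admit y = 0. *)
Lemma leq_double_subS y q n :
  (2 * y + q <= n) && (q <= n) = (y < (n - q)./2.+1) && (q <= n).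
Proof. by lia. Qed.

Lemma leq_doubleS_sub y q n : ((2 * y).+1 + q <= n) = (y < (n.+1 - q)./2).
Proof. by lia. Qed.

(** For even k the central placement only needs j <= y, which the off-centre condition implies. The
    quotient stands on the left to avoid a subtraction. *)
Lemma admissible_count_even_even h j : 0 < j <= h ->
  \sum_(0 <= x < 2 * h.+1) admissible (2 * h) x (2 * j)
    + uphalf (2 * h %/ (2 * j).+1) = h - j + 1.
Proof.
move=> /andP[j0 jh]; set q := _ %/ _.
have qn : q + 2 * j <= 2 * h by apply: divnS_addn_le; rewrite leq_pmul2l.
rewrite sum_nat_even_odd.
rewrite (eq_bigr (fun y => (j <= y < h.+1 - uphalf q) : nat)); last first.
  move=> y _; rewrite admissible_double -/q leq_double_sub andbC !oddM /=.
  congr (nat_of_bool (_ && _)); rewrite !andbT leq_pmul2l //.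
  by case: (leqP j y) => jy; rewrite ?orbT // orbF; clear -j0 jy; lia.
rewrite [X in _ + X + _]big1 => [|y _]; last first.
  by rewrite admissible_doubleS oddM /= andbF.
by rewrite sum_nat_between; clearbody q; clear -qn jh; lia.
Qed.

Lemma admissible_count_even_odd h i : i < h ->
  \sum_(0 <= x < 2 * h.+1) admissible (2 * h) x (2 * i).+1
    + uphalf (2 * h %/ (2 * i).+2) = h - (2 * i).+1 + 1.
Proof.
move=> ih; set q := _ %/ _.
have q2 : 2 * (2 * i).+1 <= 2 * h -> q + 2 * (2 * i).+1 <= (2 * h).+1.
  exact: divnS_add2n_le.
have q1 : 2 * h <= 2 * (2 * i).+1 + 1 -> q = 1.
  by apply: divnS_eq1; clear -ih; lia.
rewrite sum_nat_even_odd.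
rewrite (eq_bigr (fun y => ((2 * i).+1 <= y < h.+1 - uphalf q) : nat)); last first.
  move=> y _; rewrite admissible_double -/q leq_double_sub andbC oddS !oddM /=.
  by rewrite andbF orbF.
rewrite [X in _ + X + _]big1 => [|y _]; last first.
  by rewrite admissible_doubleS oddM /= andbF.
rewrite sum_nat_between addn0; clearbody q.
case: (leqP (2 * i).+1 h) => ih'.
  have {q1}q2 : q + 2 * (2 * i).+1 <= (2 * h).+1 by apply: q2; rewrite leq_pmul2l.
  by clear -q2 ih'; lia.
by rewrite q1 /=; clear -ih'; lia.
Qed.

(** Even and odd x contribute the floor and the ceiling of (n - q) / 2; these add up to n - q, so q
    enters unhalved. *)
Lemma admissible_count_odd_even h i : 0 < i <= h ->
  \sum_(0 <= x < 2 * h.+1) admissible (2 * h).+1 x (2 * i)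
    + (2 * h).+1 %/ (2 * i).+1 = (2 * h).+1 - 4 * i + 1.
Proof.
move=> /andP[i0 ih]; set q := _ %/ _.
have qn : q <= (2 * h).+1 by apply: leq_div.
have q2 : 2 * (2 * i) <= (2 * h).+1 -> q + 2 * (2 * i) <= (2 * h).+2.
  by apply: divnS_add2n_le; rewrite muln_gt0.
have q1 : (2 * h).+1 <= 2 * (2 * i) + 1 -> q = 1.
  by apply: divnS_eq1; clear -ih; lia.
rewrite sum_nat_even_odd.
rewrite (eq_bigr (fun y => (2 * i <= y < ((2 * h).+1 - q)./2.+1) : nat)); last first.
  move=> y _; rewrite admissible_double -/q oddS !oddM /= !andbF orbF andbC.
  by have := leq_double_subS y q (2 * h).+1; rewrite qn !andbT => ->.
rewrite [X in _ + X + _](eq_bigr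
  (fun y => (2 * i <= y < ((2 * h).+2 - q)./2) : nat)); last first.
  move=> y _; rewrite admissible_doubleS -/q leq_doubleS_sub oddS !oddM /=.
  by rewrite andbF orbF andbC.
rewrite !sum_nat_between; clearbody q.
case: (leqP (2 * (2 * i)) (2 * h).+1) => ih'.
  by have {q1}q2 := q2 ih'; clear -q2 ih' qn; lia.
by rewrite q1; clear -ih'; lia.
Qed.

Lemma admissible_count_odd_odd h i : i <= h ->
  \sum_(0 <= x < 2 * h.+1) admissible (2 * h).+1 x (2 * i).+1
    + (2 * h).+1 %/ (2 * i).+2 = (h.+1 - i) + (h - 2 * i).
Proof.
move=> ih; set q := _ %/ _.
have qn' : q + (2 * i).+1 <= (2 * h).+1.
  by apply: divnS_addn_le; rewrite ltnS leq_pmul2l.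
have qn : q <= (2 * h).+1 by apply: leq_div.
have q2 : 2 * (2 * i).+1 <= (2 * h).+1 -> q + 2 * (2 * i).+1 <= (2 * h).+2.
  exact: divnS_add2n_le.
have q1 : i < h -> (2 * h).+1 <= 2 * (2 * i).+1 + 1 -> q = 1.
  by move=> lt; apply: divnS_eq1; rewrite ltnS ltn_pmul2l.
rewrite sum_nat_even_odd.
rewrite (eq_bigr (fun y => ((2 * i).+1 <= y < ((2 * h).+1 - q)./2.+1) : nat)); last first.
  move=> y _; rewrite admissible_double -/q !oddS !oddM /= !andbF orbF andbC.
  by have := leq_double_subS y q (2 * h).+1; rewrite qn !andbT => ->.
rewrite [X in _ + X + _](eq_bigr (fun y => (i <= y < ((2 * h).+2 - q)./2) : nat)); last first.
  move=> y _; rewrite admissible_doubleS -/q leq_doubleS_sub !oddS !oddM /=.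
  rewrite andbT ltnS leq_pmul2l // andbC; congr (nat_of_bool (_ && _)).
  by case: (leqP i y) => iy; rewrite ?orbT // orbF; clear -iy; lia.
rewrite !sum_nat_between; clearbody q.
case: (leqP (2 * (2 * i).+1) (2 * h).+1) => ih'.
  by have {q1}q2 := q2 ih'; clear -q2 ih' qn; lia.
case: (ltnP i h) => ih2; first by rewrite q1 //; clear -ih' ih2; lia.
(* Here k = n, the all-zero string, and the quotient is 0 instead of 1. *)
have iE : i = h by apply/eqP; rewrite eqn_leq ih.
have q0 : q = 0 by clear -qn' iE; lia.
by rewrite iE q0; clear; lia.
Qed.

(* Both sides count the pairs [(i, d)] with [d > 0] and [(2 * i).+1 * d <= 2 * h]. *)
Lemma sum_uphalf_divn h :
  \sum_(0 <= k < 2 * h) uphalf (2 * h %/ k.+1) =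
  \sum_(0 <= i < h.+1) 2 * h %/ (2 * i).+1.
Proof.
transitivity (\sum_(0 <= k < 2 * h) \sum_(0 <= i < h.+1) ((2 * i).+1 * k.+1 <= 2 * h)).
  apply: eq_bigr => k _.
  (* There are [uphalf q] odd numbers between 1 and q. *)
  rewrite (eq_bigr (fun i => (0 <= i < uphalf (2 * h %/ k.+1)) : nat)).
    by rewrite sum_nat_between; have := leq_div (2 * h) k.+1; move: (_ %/ _) => q; lia.
  by move=> i _; rewrite -leq_divRL //; move: (_ %/ _) => q; congr nat_of_bool; lia.
rewrite exchange_big /=; apply: eq_bigr => i _.
rewrite (eq_bigr (fun k => (0 <= k < 2 * h %/ (2 * i).+1) : nat)).
  by rewrite sum_nat_between; have := leq_div (2 * h) (2 * i).+1; move: (_ %/ _) => q; lia.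
by move=> k _; rewrite mulnC -leq_divRL.
Qed.

(** * Closed forms of the elementary sums *)

Lemma sum_subn h : 2 * \sum_(0 <= i < h) (h - i) = h * h.+1.
Proof.
elim: h => [|h IH]; first by rewrite big_geq.
by rewrite big_nat_recl //= mulnDr IH; lia.
Qed.

(** Raising h by 2 shifts the truncated terms of the next three sums by one index, hence induction
    with step two. *)
Lemma nat_ind2 (P : nat -> Prop) :
  P 0 -> P 1 -> (forall h, P h -> P h.+2) -> forall h, P h.
Proof.
move=> P0 P1 PS h; suff : P h /\ P h.+1 by case.
by elim: h => [|h [Ph PhS]]; split=> //; apply: PS.
Qed.

Lemma sum_subn_odd h :
  4 * \sum_(0 <= i < h) (h - (2 * i).+1) + odd h = h * h.
Proof.
elim/nat_ind2: h => [||h IH]; [by rewrite big_geq|by rewrite big_nat1|].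
rewrite big_nat_recl //= big_nat_recr //= (eq_bigr (fun i => h - (2 * i).+1)).
  by rewrite negbK; lia.
by move=> i _; lia.
Qed.

Lemma sum_subn_even h :
  4 * \sum_(0 <= i < h.+1) (h - 2 * i) = h * h.+2 + odd h.
Proof.
elim/nat_ind2: h => [||h IH]; first by rewrite big_nat1.
  by rewrite big_nat_recr //= big_nat1.
rewrite big_nat_recl //= big_nat_recr //= (eq_bigr (fun i => h - 2 * i)).
  by rewrite negbK; lia.
by move=> i _; lia.
Qed.

Lemma sum_subn_mul4 h :
  2 * \sum_(0 <= i < h) ((2 * h).+1 - 4 * i.+1) + h = h * h.
Proof.
elim/nat_ind2: h => [||h IH]; [by rewrite big_geq|by rewrite big_nat1|].
rewrite big_nat_recl //= big_nat_recr //=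
  (eq_bigr (fun i => (2 * h).+1 - 4 * i.+1)).
  by lia.
by move=> i _; lia.
Qed.

Lemma admissible_count0 n N : n < N ->
  \sum_(0 <= x < N) admissible n x 0 = 1.
Proof.
move=> nN; rewrite (eq_bigr (fun x => (0 <= x < 1) : nat)).
  by rewrite sum_nat_between; lia.
by move=> x _; rewrite admissibleE divn1; congr nat_of_bool; lia.
Qed.

(** * The cardinality for even and for odd n *)

(** Clearing the denominator 4 keeps the identity in [nat], and [odd h] merges the cases 4 | n and
    its negation. *)
Lemma card_Shat_even h m : 0 < h -> (Shat (2 * h) #= `I_m)%card ->
  4 * (m + \sum_(1 <= i < h.+1) (2 * h) %/ (2 * i + 1)) + odd h =
  4 + 2 * (h * (h + 1)) + h * h.
Proof.
move=> h0 cm; have nN : 2 * h < 2 * h.+1 by lia.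
have := card_Shat _ _ nN; rewrite (card_eql cm) => /card_eq_II ->.
rewrite big_nat_recl // admissible_count0 // sum_nat_even_odd.
have e : \sum_(0 <= i < h) \sum_(0 <= x < 2 * h.+1) admissible (2 * h) x (2 * i).+1
  + \sum_(0 <= i < h) \sum_(0 <= x < 2 * h.+1) admissible (2 * h) x (2 * i).+2
  + \sum_(0 <= k < 2 * h) uphalf (2 * h %/ k.+2)
  = \sum_(0 <= i < h) (h - (2 * i).+1) + h + \sum_(0 <= i < h) (h - i).
  rewrite [\sum_(0 <= k < 2 * h) _]sum_nat_even_odd addnACA.
  congr (_ + _); rewrite -big_split /=.
    (* The summand h becomes a sum of ones, so that both sides compare termwise. *)
    rewrite -[X in _ = _ + X]muln1 -[X in _ = _ + X * _]subn0.
    rewrite -sum_nat_const_nat -big_split /=; apply: eq_big_nat => i ih.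
    by rewrite admissible_count_even_odd.
  apply: eq_big_nat => i ih; have -> : (2 * i).+2 = 2 * i.+1 by lia.
  by rewrite admissible_count_even_even; lia.
(* Compared with [sum_uphalf_divn], the divisor 1 is dropped (h on the left, 2h on the right) and
   the divisor 2h + 1 adds 0. *)
have u : \sum_(0 <= k < 2 * h) uphalf (2 * h %/ k.+2) =
    h + \sum_(1 <= i < h.+1) (2 * h) %/ (2 * i + 1).
  rewrite [X in _ = _ + X](eq_bigr (fun i => 2 * h %/ (2 * i).+1)); last first.
    by move=> i _; rewrite addn1.
  have := sum_uphalf_divn h; rewrite [RHS]big_ltn // muln0 divn1.
  have : \sum_(0 <= k < (2 * h).+1) uphalf (2 * h %/ k.+1) =
         \sum_(0 <= k < 2 * h) uphalf (2 * h %/ k.+1).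
    by rewrite big_nat_recr //= (divn_small (ltnSn _)) addn0.
  rewrite big_nat_recl // divn1 => <-; lia.
have := sum_subn h; have := sum_subn_odd h; lia.
Qed.

Lemma card_Shat_odd h m : 0 < h -> (Shat (2 * h).+1 #= `I_m)%card ->
  4 * (m + \sum_(1 <= i < ((2 * h).+1 - 2).+1) (2 * h).+1 %/ (i + 1)) =
  2 * (h * h) + 2 * h + 2 * ((h + 1) * (h + 2)) + h * (h + 2) + odd h.
Proof.
move=> h0 cm; have nN : (2 * h).+1 < 2 * h.+1 by lia.
have := card_Shat _ _ nN; rewrite (card_eql cm) => /card_eq_II ->.
(* Splitting off k = 0 and k = n leaves 2h values of k to separate by parity. *)
rewrite big_nat_recl // admissible_count0 // big_nat_recr //= sum_nat_even_odd.
have e : \sum_(0 <= i < h.+1) \sum_(0 <= x < 2 * h.+1) admissible (2 * h).+1 x (2 * i).+1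
  + \sum_(0 <= i < h) \sum_(0 <= x < 2 * h.+1) admissible (2 * h).+1 x (2 * i).+2
  + \sum_(0 <= k < (2 * h).+1) (2 * h).+1 %/ k.+2
  = (\sum_(0 <= i < h.+1) (h.+1 - i) + \sum_(0 <= i < h.+1) (h - 2 * i))
    + (\sum_(0 <= i < h) ((2 * h).+1 - 4 * i.+1) + h).
  have -> : \sum_(0 <= k < (2 * h).+1) (2 * h).+1 %/ k.+2 =
      \sum_(0 <= i < h.+1) (2 * h).+1 %/ (2 * i).+2 +
      \sum_(0 <= i < h) (2 * h).+1 %/ (2 * i).+3.
    by rewrite !big_nat_recr //= sum_nat_even_odd addnAC.
  rewrite addnACA; congr (_ + _); rewrite -!big_split /=.
    by apply: eq_big_nat => i ih; rewrite admissible_count_odd_odd.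
  rewrite -[X in _ = _ + X]muln1 -[X in _ = _ + X * _]subn0.
  rewrite -sum_nat_const_nat -big_split /=; apply: eq_big_nat => i ih.
  have -> : (2 * i).+2 = 2 * i.+1 by lia.
  by rewrite admissible_count_odd_even; lia.
(* The divisors run from 2 to n + 1 on the left and to n - 1 on the right; n contributes 1 and n + 1
   contributes 0. *)
have s : \sum_(0 <= k < (2 * h).+1) (2 * h).+1 %/ k.+2 =
    1 + \sum_(1 <= i < ((2 * h).+1 - 2).+1) (2 * h).+1 %/ (i + 1).
  have [H ->] : exists H, 2 * h = H.+1 by exists (2 * h).-1; lia.
  rewrite subn2 big_add1 /= 2?big_nat_recr //= divnn divn_small // addn0 addnC.
  by congr (_ + _); apply: eq_bigr => i _; rewrite addn1.
have := sum_subn h.+1; have := sum_subn_even h; have := sum_subn_mul4 h.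
move: e; rewrite big_nat_recr //=; lia.
Qed.

Local Open Scope classical_set_scope.
Local Open Scope ring_scope.

Theorem theorem5p4 (n : nat) (hn : (2 <= n)%N) :
  exists m : nat, (Shat n #= `I_m)%card /\
    (~~ odd n ->
      (m%:R : rat) =
        if (4 %| n)%N then
          1 + n%:R * (n%:R + 2) / 8
            - (\sum_(1 <= i < (n %/ 2).+1) n %/ (2 * i + 1))%N%:R
            + n%:R ^+ 2 / 16
        else
          1 + n%:R * (n%:R + 2) / 8
            - (\sum_(1 <= i < (n %/ 2).+1) n %/ (2 * i + 1))%N%:R
            + (n%:R ^+ 2 - 4) / 16) /\
    (odd n ->
      ((4 %| n - 1)%N ->
        (m%:R : rat) =
          1 + 5 * (n%:R + 3) * (n%:R - 1) / 16
            - (\sum_(1 <= i < (n - 2).+1) n %/ (i + 1))%N%:R) /\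
      ((4 %| n + 1)%N ->
        (m%:R : rat) =
          1 + (n%:R + 3) * (n%:R - 1) / 4
            - (\sum_(1 <= i < (n - 2).+1) n %/ (i + 1))%N%:R
            + (n%:R + 1) ^+ 2 / 16)).
Proof.
have [h [nE|nE]] : exists h, n = (2 * h)%N \/ n = (2 * h).+1%N.
    by exists n./2; lia.
  have h0 : (0 < h)%N by lia.
  rewrite nE; exists (\sum_(0 <= k < (2 * h).+1)
    \sum_(0 <= x < (2 * h).+1) admissible (2 * h) x k)%N.
  set m := (\sum_(0 <= k < _) _)%N.
  have cm : (Shat (2 * h) #= `I_m)%card by apply: card_Shat.
  split=> //; split=> [_|]; last by lia.
  have := card_Shat_even _ _ h0 cm.
  have -> : (2 * h %/ 2)%N = h by rewrite mulKn.
  (* The parity of h decides the case, and the identity in [nat], cast to [rat], is linear in the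
     sum [S]. *)
  have -> : (4 %| 2 * h)%N = ~~ odd h by lia.
  move: (\sum_(1 <= i < h.+1) _)%N => S /(congr1 (fun t => t%:R : rat)).
  by rewrite !(GRing.natrD, GRing.natrM); case: (odd h) => /= e; lra.
have h0 : (0 < h)%N by lia.
rewrite nE; exists (\sum_(0 <= k < (2 * h).+2)
  \sum_(0 <= x < (2 * h).+2) admissible (2 * h).+1 x k)%N.
set m := (\sum_(0 <= k < _) _)%N.
have cm : (Shat (2 * h).+1 #= `I_m)%card by apply: card_Shat.
split=> //; split=> [|_]; first by lia.
have := card_Shat_odd _ _ h0 cm.
have -> : (4 %| (2 * h).+1 - 1)%N = ~~ odd h by lia.
have -> : (4 %| (2 * h).+1 + 1)%N = odd h by lia.
have -> : (2 * h).+1%:R = 2 * h%:R + 1 :> rat by rewrite -GRing.natr1 GRing.natrM.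
move: (\sum_(1 <= i < _) _)%N => S /(congr1 (fun t => t%:R : rat)).
rewrite !(GRing.natrD, GRing.natrM).
by case: (odd h) => /= e; split=> // _; lra.
Qed.
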